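(* Let $A$ be a positive definite (Hermitian) $d\times d$ complex matrix, let $N=\{1,\dots,d\}$, and let $\alpha,\beta\subseteq N$. Put $n=|\alpha|$, $m=|\beta|$, $r=|\alpha\cup\beta|$, $s=|\alpha\cap\beta|$ (so $n+m=r+s$), and let $$x=\lambda(A[\alpha])\in\mathbb{R}^n,\quad y=\lambda(A[\beta])\in\mathbb{R}^m,\quad z=\lambda(A[\alpha\cup\beta])\in\mathbb{R}^r,\quad w=\lambda(A[\alpha\cap\beta])\in\mathbb{R}^s .$$ Then the following relations hold: (1) $(x^{\downarrow},y^{\uparrow})\prec^{*}(z^{\downarrow},w^{\downarrow})$; (2) $(x^{\downarrow},y^{\uparrow})\prec^{*}(z^{\downarrow},w^{\uparrow})$; (3) $(x^{\downarrow},y^{\downarrow})\prec^{*}(z,w)^{\downarrow}$.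
   Context: For $\gamma\subseteq N$, $A[\gamma]$ is the principal submatrix of $A$ with rows and columns indexed by $\gamma$, and $\lambda(B)$ denotes the vector of eigenvalues (with multiplicity) of a Hermitian matrix $B$. If $\gamma=\emptyset$, $\lambda(A[\gamma])$ is the empty vector in $\mathbb{R}^0$. For a real vector $v$, $v^{\downarrow}$ and $v^{\uparrow}$ denote the vectors obtained by rearranging its coordinates in non-increasing and in non-decreasing order, respectively. $(u,v)$ denotes concatenation; thus $(x^{\downarrow},y^{\uparrow})$ is the concatenation of separately sorted blocks, whereas $(z,w)^{\downarrow}$ is the rearrangement of all $r+s$ entries of the concatenated vector $(z,w)$ in non-increasing order. For vectors $a,b\in\mathbb{R}^p$ written in the displayed order (with no further rearrangement), $a\prec^{*}b$ ($*$-majorization) means $\sum_{i=1}^k a_i\le\sum_{i=1}^k b_i$ for $k=1,\dots,p$, with equality for $k=p$. *)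

(* Defs.v *)
From mathcomp Require Import all_boot all_order all_algebra.
From mathcomp Require Import reals complex.

Set Implicit Arguments.
Unset Strict Implicit.
Unset Printing Implicit Defensive.

Import Order.TTheory GRing.Theory Num.Theory.
Local Open Scope ring_scope.
Local Open Scope sesquilinear_scope.

(* In R[i], 0 < z means that z is real and positive. *)
Definition posdefmx (R : realType) d (A : 'M[R[i]]_d) : Prop :=
  A \is hermsymmx /\ forall v : 'cV[R[i]]_d, v != 0 -> 0 < (v ^t* *m A *m v) 0 0.

Definition princ_submx (R : realType) d (A : 'M[R[i]]_d) (g : {set 'I_d}) :
    'M[R[i]]_#|g| :=
  mxsub (@enum_val _ (mem g)) (@enum_val _ (mem g)) A.

(* The roots of the characteristic polynomial, listed with multiplicity in an
   unspecified order.  For Hermitian B they are real (char_poly_eigvals), and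
   taking real parts only serves to move them from R[i] to R. *)
Definition eigvals (R : realType) n (B : 'M[R[i]]_n) : seq R :=
  [seq complex.Re t | t <- sval (closed_field_poly_normal (char_poly B))].

Definition sort_dec (R : realType) (v : seq R) : seq R := sort >=%R v.

Definition sort_inc (R : realType) (v : seq R) : seq R := sort <=%R v.

(* Vectors of R^p are sequences of size p, so both being in the same R^p is
   part of the relation; the coordinates are numbered from 0. *)
Definition star_maj (R : realType) (a b : seq R) : Prop :=
  [/\ size a = size b,
      forall k : nat, (1 <= k <= size a)%N ->
        \sum_(i < k) a`_i <= \sum_(i < k) b`_i
    & \sum_(i < size a) a`_i = \sum_(i < size b) b`_i].

Lemma size_eigvals (R : realType) n (B : 'M[R[i]]_n) : size (eigvals B) = n.
Proof.
rewrite size_map; case: closed_field_poly_normal => r /= E.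
have := size_char_poly B.
rewrite E (monicP (char_poly_monic B)) scale1r size_prod_XsubC.
by case.
Qed.

Lemma herm_eigenvalue_real (R : realType) n (B : 'M[R[i]]_n) (a : R[i]) :
  B \is hermsymmx -> root (char_poly B) a -> a \is Num.real.
Proof.
move=> /is_hermitianmxP; rewrite expr0 scale1r => hB.
rewrite -eigenvalue_root_char => /eigenvalueP [v vB v0].
have q0 : (v *m v ^t*) 0 0 != 0.
  by rewrite -dotmxE; apply: contra v0; rewrite dnorm_eq0.
have E1 : v *m B *m v ^t* = a *: (v *m v ^t*) by rewrite vB scalemxAl.
have E2 : v *m B *m v ^t* = a^* *: (v *m v ^t*).
  rewrite -mulmxA hB -map_mxM -trmx_mul vB.
  by rewrite linearZ /= map_mxZ scalemxAr.
apply/CrealP; apply: (mulIf q0).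
by have /matrixP/(_ 0 0) := etrans (esym E2) E1; rewrite !mxE => ->.
Qed.

Lemma char_poly_eigvals (R : realType) n (B : 'M[R[i]]_n) :
  B \is hermsymmx ->
  char_poly B = \prod_(t <- eigvals B) ('X - (real_complex R t)%:P).
Proof.
move=> hB; rewrite big_map; case: closed_field_poly_normal => r /= E.
move: E; rewrite (monicP (char_poly_monic B)) scale1r => E.
rewrite {1}E; apply: eq_big_seq => t tr; congr ('X - _%:P).
apply/esym/RRe_real.
by apply: (herm_eigenvalue_real hB); rewrite E root_prod_XsubC.
Qed.

Lemma princ_submx_herm (R : realType) d (A : 'M[R[i]]_d) (g : {set 'I_d}) :
  A \is hermsymmx -> princ_submx A g \is hermsymmx.
Proof.
move=> /is_hermitianmxP hA; apply/is_hermitianmxP; apply/matrixP => i j.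
by rewrite mxE {1}hA !mxE.
Qed.

(* Main.v *)
(* By Ky Fan's principle, the sum of the k largest (resp. smallest) eigenvalues
   of a Hermitian matrix is the maximum (resp. minimum) of the traces of its
   compressions to k-dimensional subspaces, so it can only decrease
   (resp. increase) when one passes to a principal submatrix.  As
   tr A[alpha] + tr A[beta] = tr A[alpha :|: beta] + tr A[alpha :&: beta], an
   inequality between partial sums of length k is equivalent to the reverse
   inequality between the complementary tails.  The partial sums with k <= n are
   compared directly, and those with k > n through their tails. *)
Require Import Defs.
From mathcomp Require Import all_boot all_order all_algebra.
From mathcomp Require Import reals complex.
From mathcomp Require Import perm lra zify.

Set Implicit Arguments.
Unset Strict Implicit.
Unset Printing Implicit Defensive.

Import Order.TTheory GRing.Theory Num.Theory.
Local Open Scope complex_scope.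
Local Open Scope ring_scope.
Local Open Scope sesquilinear_scope.

(** * Sums of the k largest and the k smallest entries of a real vector *)

Section SortedSums.
Variable R : realType.
Implicit Types (s t u : seq R) (k : nat).

Definition topsum s k := \sum_(x <- take k (sort_dec s)) x.
Definition botsum s k := \sum_(x <- drop (size s - k) (sort_dec s)) x.

Lemma perm_sort_dec s : perm_eq (sort_dec s) s.
Proof. by rewrite /sort_dec perm_sort. Qed.

Lemma size_sort_dec s : size (sort_dec s) = size s.
Proof. exact: size_sort. Qed.

Lemma size_sort_inc s : size (sort_inc s) = size s.
Proof. exact: size_sort. Qed.

Lemma sort_dec_pairwise s : pairwise >=%R (sort_dec s).
Proof.
rewrite -sorted_pairwise; last by move=> x y z /= xy yz; exact: le_trans yz xy.
by apply: sort_sorted => x y; exact: le_total.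
Qed.

Lemma perm_sort_dec_eq s t : perm_eq s t -> sort_dec s = sort_dec t.
Proof.
move=> st; apply/perm_sortP => //.
- by move=> x y; exact: le_total.
- by move=> x y z /= xy yz; exact: le_trans yz xy.
- by move=> x y /= /andP[xy yx]; apply: le_anti; rewrite yx xy.
Qed.

Lemma sort_inc_rev s : sort_inc s = rev (sort_dec s).
Proof.
apply: (@le_sorted_eq _ R); first exact: sort_le_sorted.
  rewrite rev_sorted /sort_dec; apply: sort_sorted => x y; exact: le_total.
by rewrite /sort_inc perm_sort perm_sym perm_rev perm_sort_dec.
Qed.

Lemma top_bot s k : topsum s (size s - k) + botsum s k = \sum_(x <- s) x.
Proof.
rewrite /topsum /botsum -big_cat cat_take_drop.
exact/perm_big/perm_sort_dec.
Qed.

Lemma topsum_size s : topsum s (size s) = \sum_(x <- s) x.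
Proof.
by rewrite /topsum -size_sort_dec take_size; apply/perm_big/perm_sort_dec.
Qed.

(* The right-hand side does not depend on the order of s, and it bounds the sum
   of any k entries (or any sum with weights in [0, 1] of total mass k). *)
Lemma topsum_threshold s k : (k <= size s)%N ->
  exists h, topsum s k = h *+ k + \sum_(x <- s) Num.max (x - h) 0.
Proof.
rewrite -size_sort_dec => ks; rewrite /topsum.
move: (sort_dec s) ks (perm_sort_dec s) (sort_dec_pairwise s) => S kS Ss pS.
have [h hge hle] : exists2 h, {in take k S, forall x, h <= x}
                            & {in drop k S, forall x, x <= h}.
  move: pS; rewrite -{1}(cat_take_drop k S) pairwise_cat => /and3P[].
  (* The threshold is the first entry dropped; if none is dropped, it is the last entry kept, or 0
     for an empty list. *)
  case: (drop k S) => [|y D].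
    case/lastP: (take k S) => [|T y] _ + _; first by exists 0.
    rewrite pairwise_rcons => /andP[/allP yT _]; exists y => // x.
    by rewrite mem_rcons inE => /orP[/eqP-> //|/yT].
  move=> /allrelP TD _ /= /andP[/allP yD _]; exists y => x.
    by move=> /TD; apply; rewrite mem_head.
  by rewrite inE => /orP[/eqP-> //|/yD].
exists h; rewrite -(perm_big _ Ss) -{2}(cat_take_drop k S) big_cat /=.
rewrite [X in _ + (_ + X)]big1_seq ?addr0; last first.
  by move=> x /andP[_ /hle xh]; apply/max_idPr; rewrite subr_le0.
rewrite [in RHS](eq_big_seq (fun x => x - h)); last first.
  by move=> x /hge hx /=; apply/max_idPl; rewrite subr_ge0.
rewrite sumrB big_const_seq count_predT iter_addr_0 size_takel //.
by rewrite addrC subrK.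
Qed.

Lemma sum_le_topsum s t u : perm_eq (t ++ u) s ->
  \sum_(x <- t) x <= topsum s (size t).
Proof.
move=> tus; have [|h ->] := @topsum_threshold s (size t).
  by rewrite -(perm_size tus) size_cat leq_addr.
rewrite -(perm_big _ tus) big_cat /= addrA.
rewrite -[X in X <= _]addr0; apply: lerD.
  rewrite -[h *+ _]iter_addr_0 -count_predT -big_const_seq -big_split /=.
  by apply: ler_sum => x _; rewrite -lerBlDl le_max lexx.
by apply: sumr_ge0 => x _; rewrite le_max lexx orbT.
Qed.

Lemma botsum_le_topsum s k : (k <= size s)%N -> botsum s k <= topsum s k.
Proof.
move=> ks; rewrite -{2}(_ : size (drop (size s - k) (sort_dec s)) = k).
  apply: (@sum_le_topsum _ _ (take (size s - k) (sort_dec s))).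
  by rewrite perm_catC cat_take_drop perm_sort_dec.
by rewrite size_drop size_sort_dec subKn.
Qed.

Lemma sum_ord_take (a : seq R) k : (k <= size a)%N ->
  \sum_(i < k) a`_i = \sum_(x <- take k a) x.
Proof.
move=> ka; rewrite (big_nth 0) size_takel // big_mkord.
by apply: eq_bigr => i _; rewrite nth_take.
Qed.

Lemma sum_take_sort_inc s k : \sum_(x <- take k (sort_inc s)) x = botsum s k.
Proof.
rewrite sort_inc_rev take_rev size_sort_dec /botsum.
by apply/perm_big; rewrite perm_rev.
Qed.

Section Weights.
Variables (n : nat) (c : 'I_n -> R[i]) (s : seq R) (k : nat).
Hypotheses (sn : size s = n) (kn : (k <= n)%N).
Hypotheses (c01 : forall j, 0 <= c j <= 1) (ck : \sum_j c j = k%:R).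

(** As the weights add up to [k], the term [h *+ k] cancels and the bound becomes termwise:
    [c (x - h)] is at most the positive part of [x - h]. The weights are in [R[i]] because they will
    be diagonal entries of a complex projection. *)
Lemma weighted_le_topsum : \sum_j c j * (s`_j)%:C <= (topsum s k)%:C.
Proof.
have [|h ->] := @topsum_threshold s k; first by rewrite sn.
rewrite rmorphD rmorphMn /= -mulr_natl -ck mulr_suml.
rewrite (big_nth 0) sn big_mkord rmorph_sum -big_split /=.
apply: ler_sum => j _; rewrite -lerBlDl -mulrBr -rmorphB /=.
have /andP[c0 c1] := c01 j.
have [le0|gt0] := leP (s`_j - h) 0.
  by rewrite rmorph0 mulr_ge0_le0 // (lecR _ 0).
by rewrite ler_piMl // (lecR 0) ltW.
Qed.

End Weights.

(** Apply the upper bound to the complementary weights [1 - c j], of total mass [n - k]. *)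
Lemma botsum_le_weighted n (c : 'I_n -> R[i]) s k :
  size s = n -> (k <= n)%N -> (forall j, 0 <= c j <= 1) ->
  \sum_j c j = k%:R -> (botsum s k)%:C <= \sum_j c j * (s`_j)%:C.
Proof.
move=> sn kn c01 ck.
have := @weighted_le_topsum n (fun j => 1 - c j) s (n - k) sn (leq_subr _ _).
have -> : \sum_j (1 - c j) = (n - k)%:R.
  by rewrite sumrB ck sumr_const card_ord natrB.
have c01' j : 0 <= 1 - c j <= 1.
  by have /andP[c0 c1] := c01 j; rewrite subr_ge0 c1 gerBl.
move=> /(_ c01' erefl).
under eq_bigr do rewrite mulrBl mul1r.
rewrite sumrB lerBlDr -lerBlDl; apply: le_trans.
have -> : \sum_(j < n) (s`_j)%:C = (\sum_(x <- s) x)%:C.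
  by rewrite (big_nth 0) sn big_mkord rmorph_sum.
by rewrite -(top_bot s k) sn rmorphD /= addrC addKr.
Qed.

End SortedSums.

(** * Ky Fan's principle and its consequences for submatrices *)

Section KyFan.
Variable R : realType.
Local Notation C := (R[i]).

(** The spectral theorem gives the eigenvalues in some order. Comparing characteristic polynomials
    shows that they are a permutation of [eigvals B], and permuting the rows of the unitary matrix
    sorts them. *)
Lemma hermitian_diagonalization n (B : 'M[C]_n) : B \is hermsymmx ->
  exists2 U : 'M[C]_n, U \is unitarymx &
    B = U^t* *m diag_mx (\row_j ((sort_dec (eigvals B))`_j)%:C) *m U.
Proof.
move=> hB; have /orthomx_spectralP eB := hermitian_normalmx hB.
have /mxOverP rD := hermitian_spectral_diag_real hB.
set P := spectralmx B in eB; set D := spectral_diag B in eB rD.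
have PU : P \is unitarymx := spectral_unitarymx B.
pose t := [tuple complex.Re (D 0 j) | j < n].
have Dt j : D 0 j = (tnth t j)%:C by rewrite tnth_mktuple RRe_real.
have cB : char_poly B = \prod_(x <- t) ('X - (x%:C)%:P).
  rewrite big_tuple.
  have -> : char_poly B = char_poly (diag_mx D).
    rewrite /char_poly /char_poly_mx eB !map_mxM /=.
    have PV : map_mx polyC (invmx P) *m map_mx polyC P = 1%:M.
      by rewrite -map_mxM mulVmx ?unitarymx_unit ?map_mx1.
    (* The scalar matrix is conjugated as well, so that the determinants of the conjugating matrices
       cancel. *)
    rewrite -[X in X - _](_ : map_mx polyC (invmx P) *m 'X%:M *m map_mx polyC P = _).
      rewrite -mulmxBl -mulmxBr !det_mulmx mulrAC -det_mulmx PV det1 mul1r //.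
    by rewrite -mulmxA mul_scalar_mx -scalemxAr PV scalemx1.
  rewrite char_poly_trig ?diag_mx_is_trig //.
  by apply: eq_bigr => j _; rewrite mxE eqxx mulr1n Dt.
have perm_t : perm_eq (sort_dec (eigvals B)) t.
  rewrite (perm_trans (perm_sort_dec _)) //.
  apply: (perm_map_inj (@complexI R)); apply: prod_XsubC_eq.
  by rewrite !(big_map (real_complex R)) -cB char_poly_eigvals.
have sz : size (sort_dec (eigvals B)) == n.
  by rewrite size_sort_dec size_eigvals.
have /tuple_permP[p ep] : perm_eq (Tuple sz) t by [].
exists (rowsub p P).
  apply/row_unitarymxP => i j; rewrite !row_rowsub.
  by rewrite (row_unitarymxP PU) (inj_eq perm_inj).
rewrite {1}eB invmx_unitary //; apply/matrixP => i j.
rewrite !mxE (reindex_inj (@perm_inj _ p)) /=; apply: eq_bigr => l _.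
rewrite !mul_mx_diag !mxE Dt; congr (_ * _%:C * _).
by rewrite -[sort_dec _]/(tval (Tuple sz)) ep -tnth_nth [RHS]tnth_mktuple.
Qed.

Lemma trace_unitary_diag k n (W : 'M[C]_(k, n)) (D : 'rV[C]_n) :
  \tr (W *m diag_mx D *m W^t*) = \sum_j (W^t* *m W) j j * D 0 j.
Proof.
rewrite mxtrace_mulC mulmxA /mxtrace; apply: eq_bigr => j _.
by rewrite mul_mx_diag mxE.
Qed.

(* [W^t* *m W] is an orthogonal projection, so its diagonal entries q satisfy
   q ^+ 2 <= q. *)
Lemma unitary_weights k n (W : 'M[C]_(k, n)) : W \is unitarymx ->
  forall j, 0 <= (W^t* *m W) j j <= 1.
Proof.
move=> /unitarymxP WW j; set Q := W^t* *m W.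
have Q2 : Q *m Q = Q by rewrite /Q mulmxA -(mulmxA _ W) WW mulmx1.
have QH a b : Q b a = (Q a b)^*.
  rewrite !mxE rmorph_sum; apply: eq_bigr => l _ /=.
  by rewrite !mxE rmorphM /= conjCK mulrC.
have q0 : 0 <= Q j j.
  rewrite !mxE sumr_ge0 // => l _; rewrite !mxE mulrC; exact: mul_conjC_ge0.
rewrite q0 /=; move: q0; rewrite le_eqVlt => /orP[/eqP<-|q0]; first exact: ler01.
(* The terms of [(Q *m Q) j j] other than the square of [Q j j] are squared moduli. *)
rewrite -(ler_pM2l q0) mulr1 -[in leRHS]Q2 [leRHS]mxE (bigD1 j) //= lerDl.
by apply: sumr_ge0 => l _; rewrite QH mulrC mul_conjC_ge0.
Qed.

(** In an eigenbasis of [B] the trace is a weighted sum of eigenvalues. The weights are the diagonal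
    entries of a projection of rank [k], so they lie in [0, 1] and add up to [k]. *)
Lemma ky_fan k n (B : 'M[C]_n) (V : 'M[C]_(k, n)) : (k <= n)%N ->
  B \is hermsymmx -> V \is unitarymx ->
  (botsum (eigvals B) k)%:C <= \tr (V *m B *m V^t*) <= (topsum (eigvals B) k)%:C.
Proof.
move=> kn hB VU; have [U UU eB] := hermitian_diagonalization hB.
pose W := V *m U^t*.
have WU : W \is unitarymx by apply: mul_unitarymx; rewrite ?trmxC_unitary.
have -> : V *m B *m V^t* =
    W *m diag_mx (\row_j ((sort_dec (eigvals B))`_j)%:C) *m W^t*.
  have -> : W^t* = U *m V^t* by rewrite trmx_mul map_mxM trmxCK.
  by rewrite {1}eB /W !mulmxA.
rewrite trace_unitary_diag.
under eq_bigr => j _ do rewrite [(\row_j _) _ _]mxE.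
have c01 := unitary_weights WU.
have ck : \sum_j (W^t* *m W) j j = k%:R.
  by rewrite -/(mxtrace _) mxtrace_mulC (unitarymxP WU) mxtrace1.
have st : perm_eq (sort_dec (eigvals B)) (eigvals B) := perm_sort_dec _.
have sn : size (sort_dec (eigvals B)) = n by rewrite size_sort_dec size_eigvals.
have := weighted_le_topsum sn kn c01 ck.
have := botsum_le_weighted sn kn c01 ck.
by rewrite /topsum /botsum (perm_sort_dec_eq st) size_sort_dec => -> ->.
Qed.

(** The rows of [V] are the eigenvectors numbered by [g]. Leaving [g] free covers both the largest
    and the smallest eigenvalues. *)
Lemma ky_fan_attained k n (B : 'M[C]_n) (g : 'I_k -> 'I_n) : injective g ->
  B \is hermsymmx -> exists2 V : 'M[C]_(k, n), V \is unitarymx &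
  \tr (V *m B *m V^t*) = (\sum_(i < k) (sort_dec (eigvals B))`_(g i))%:C.
Proof.
move=> gI hB; have [U UU eB] := hermitian_diagonalization hB.
set D := diag_mx _ in eB.
have UBU : U *m B *m U^t* = D.
  rewrite eB !mulmxA (unitarymxP UU) mul1mx -mulmxA (unitarymxP UU).
  by rewrite mulmx1.
exists (rowsub g U).
  apply/row_unitarymxP => i j; rewrite !row_rowsub.
  by rewrite (row_unitarymxP UU) (inj_eq gI).
have -> : rowsub g U *m B *m (rowsub g U)^t* = mxsub g g D.
  rewrite -UBU mul_rowsub_mx [RHS]mxsub_mul; congr (_ *m _).
  by apply/matrixP => i j; rewrite !mxE.
by rewrite rmorph_sum; apply: eq_bigr => i _; rewrite !mxE eqxx.
Qed.

Lemma hermsymmx_mxsub p n (B : 'M[C]_n) (f : 'I_p -> 'I_n) :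
  B \is hermsymmx -> mxsub f f B \is hermsymmx.
Proof.
move=> /is_hermitianmxP hA; apply/is_hermitianmxP; apply/matrixP => i j.
by rewrite mxE {1}hA !mxE.
Qed.

(** With [S] the coordinate rows selected by [f], a compression of the submatrix by [V] is the
    compression of [B] by [V *m S], whose rows are still orthonormal. *)
Lemma ky_fan_mxsub p n k (B : 'M[C]_n) (f : 'I_p -> 'I_n) (V : 'M[C]_(k, p)) :
  (k <= n)%N -> injective f -> B \is hermsymmx -> V \is unitarymx ->
  (botsum (eigvals B) k)%:C <= \tr (V *m mxsub f f B *m V^t*)
    <= (topsum (eigvals B) k)%:C.
Proof.
move=> kn fI hB VU; pose S : 'M[C]_(p, n) := rowsub f 1%:M.
have SU : S \is unitarymx.
  apply/row_unitarymxP => i j; rewrite !row_rowsub.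
  rewrite (row_unitarymxP _) ?(inj_eq fI) //.
  by apply/unitarymxP; rewrite trmx1 map_mx1 mulmx1.
have -> : V *m mxsub f f B *m V^t* = (V *m S) *m B *m (V *m S)^t*.
  have -> : mxsub f f B = S *m B *m S^t*.
    rewrite -rowsubE -{1}[B]mulmx1 mxsub_mul; congr (_ *m _).
    by apply/matrixP => i j; rewrite !mxE rmorph_nat eq_sym.
  by rewrite trmx_mul map_mxM !mulmxA.
by apply: ky_fan => //; exact: mul_unitarymx.
Qed.

Section Submatrix.
Variables (p n : nat) (B : 'M[C]_n) (f : 'I_p -> 'I_n).
Hypotheses (fI : injective f) (hB : B \is hermsymmx).

Lemma submx_size : (p <= n)%N.
Proof. by have := leq_card _ fI; rewrite !card_ord. Qed.

(** The [V] that attains the top sum of the submatrix is a competitor in Ky Fan's bound for [B]. *)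
Lemma topsum_mxsub k : (k <= p)%N ->
  topsum (eigvals (mxsub f f B)) k <= topsum (eigvals B) k.
Proof.
move=> kp; have kn := leq_trans kp submx_size.
have gI : injective (widen_ord kp) by move=> i j [/val_inj].
have [V VU e] := ky_fan_attained gI (hermsymmx_mxsub f hB).
have := ky_fan_mxsub kn fI hB VU; rewrite e => /andP[_].
by rewrite lecR sum_ord_take // size_sort_dec size_eigvals.
Qed.

Lemma botsum_mxsub k : (k <= p)%N ->
  botsum (eigvals B) k <= botsum (eigvals (mxsub f f B)) k.
Proof.
move=> kp; have kn := leq_trans kp submx_size.
(* In decreasing order, the [k] smallest of [p] eigenvalues start at index [p - k]. *)
have gP (i : 'I_k) : (p - k + i < p)%N.
  by rewrite -[X in (_ < X)%N](subnK kp) ltn_add2l.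
have gI : injective (fun i => Ordinal (gP i)).
  by move=> i j [/addnI/val_inj].
have [V VU e] := ky_fan_attained gI (hermsymmx_mxsub f hB).
have := ky_fan_mxsub kn fI hB VU; rewrite e => /andP[+ _].
rewrite lecR /= /botsum size_eigvals => h; apply: le_trans h _.
rewrite [X in _ <= X](big_nth 0) size_drop size_sort_dec size_eigvals subKn //.
by rewrite big_mkord; apply: ler_sum => i _; rewrite nth_drop.
Qed.

End Submatrix.

Lemma sum_eigvals n (B : 'M[C]_n) : B \is hermsymmx ->
  (\sum_(x <- eigvals B) x)%:C = \tr B.
Proof.
move=> hB; have [U UU eB] := hermitian_diagonalization hB.
rewrite {2}eB mxtrace_mulC mulmxA (unitarymxP UU) mul1mx mxtrace_diag.
rewrite -(perm_big _ (perm_sort_dec _)) (big_nth 0) size_sort_dec size_eigvals.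
by rewrite big_mkord rmorph_sum; apply: eq_bigr => j _; rewrite mxE.
Qed.

End KyFan.

(** * Nested principal submatrices, and sums of eigenvalues as traces *)

Section PrincipalSubmatrices.
Variables (R : realType) (d : nat) (A : 'M[R[i]]_d).
Hypothesis hA : A \is hermsymmx.
Implicit Types g h : {set 'I_d}.
Local Notation ev g := (eigvals (princ_submx A g)).

(** [f] sends the position of an element in the enumeration of [g] to its position in that of [h];
    this makes the bounds on [mxsub] available. *)
Lemma princ_submx_subset g h : g \subset h ->
  exists2 f : 'I_#|g| -> 'I_#|h|, injective f &
    princ_submx A g = mxsub f f (princ_submx A h).
Proof.
move=> gh; have ih (i : 'I_#|g|) : enum_val i \in h.
  by rewrite (subsetP gh) // enum_valP.
exists (fun i => enum_rank_in (ih i) (enum_val i)).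
  move=> i j /(congr1 enum_val); rewrite !enum_rankK_in //.
  exact: enum_val_inj.
by apply/matrixP => i j; rewrite !mxE !enum_rankK_in.
Qed.

Lemma topsum_subset g h k : g \subset h -> (k <= #|g|)%N ->
  topsum (ev g) k <= topsum (ev h) k.
Proof.
by move=> /princ_submx_subset[f fI ->]; apply/topsum_mxsub/princ_submx_herm.
Qed.

Lemma botsum_subset g h k : g \subset h -> (k <= #|g|)%N ->
  botsum (ev h) k <= botsum (ev g) k.
Proof.
by move=> /princ_submx_subset[f fI ->]; apply/botsum_mxsub/princ_submx_herm.
Qed.

Lemma sum_ev g : (\sum_(x <- ev g) x)%:C = \sum_(i in g) A i i.
Proof.
rewrite sum_eigvals ?princ_submx_herm // big_enum_val /=.
by apply: eq_bigr => i _; rewrite mxE.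
Qed.

Lemma sum_ev_disjoint g h : [disjoint g & h] ->
  \sum_(x <- ev (g :|: h)) x = \sum_(x <- ev g) x + \sum_(x <- ev h) x.
Proof.
move=> gh; apply: (@complexI R); rewrite rmorphD /= !sum_ev.
by rewrite -bigU //; apply: eq_bigl => i; rewrite !inE.
Qed.

(** Both sides are sums of diagonal entries of [A] in which exactly the indices of [g :&: h] count
    twice. *)
Lemma sum_ev_UI g h :
  \sum_(x <- ev g) x + \sum_(x <- ev h) x =
  \sum_(x <- ev (g :|: h)) x + \sum_(x <- ev (g :&: h)) x.
Proof.
apply: (@complexI R); rewrite !rmorphD /= !sum_ev.
rewrite [in RHS](big_setID g) (big_setID (A := h) g) /=.
rewrite setUK setDUl setDv set0U (setIC h g).
by rewrite -addrA [in RHS](addrC (\sum_(i in h :\: g) A i i)).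
Qed.

(* Compare both sides with the trace of the principal submatrix indexed by
   [g :&: h] and j - #|g :&: h| further elements e of h. *)
Lemma sum_ev_capU_le g h j : (#|g :&: h| <= j <= #|h|)%N ->
  \sum_(x <- ev (g :&: h)) x + botsum (ev (g :|: h)) (j - #|g :&: h|)
    <= topsum (ev h) j.
Proof.
move=> /andP[sj jm].
have [e esub ecard] : exists2 e : {set 'I_d},
    e \subset h :\: g & #|e| = (j - #|g :&: h|)%N.
  have le_e : (j - #|g :&: h| <= #|h :\: g|)%N.
    by rewrite cardsD setIC leq_sub2r.
  exists [set x in take (j - #|g :&: h|) (enum (h :\: g))].
    by apply/subsetP => i; rewrite inE => /mem_take; rewrite mem_enum.
  rewrite cardsE (card_uniqP _) ?take_uniq ?enum_uniq //.
  by rewrite size_takel // -cardE.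
have [eh eg] : e \subset h /\ [disjoint g & e].
  by move: esub; rewrite subsetD disjoint_sym => /andP[].
have dis : [disjoint g :&: h & e].
  by apply: disjointWl eg; exact: subsetIl.
have card_e : #|(g :&: h) :|: e| = j.
  by rewrite cardsU (disjoint_setI0 dis) cards0 subn0 ecard subnKC.
have sub_h : (g :&: h) :|: e \subset h by rewrite subUset subsetIr eh.
have j_le : (j <= #|(g :&: h) :|: e|)%N by rewrite card_e.
apply: le_trans (topsum_subset sub_h j_le).
have <- : size (ev (g :&: h :|: e)) = j by rewrite size_eigvals card_e.
rewrite topsum_size sum_ev_disjoint // lerD2l size_eigvals card_e.
(* It remains to bound from below the trace of the submatrix indexed by [e], which is its top sum of
   full length [#|e|]. *)
have eU : e \subset g :|: h by rewrite (subset_trans eh) ?subsetUr.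
have := botsum_subset eU (leqnn #|e|).
move=> /le_trans; rewrite -{1}ecard; apply.
by rewrite -topsum_size size_eigvals botsum_le_topsum ?size_eigvals.
Qed.

End PrincipalSubmatrices.

(** * Majorization relations between the four spectra *)

Lemma star_majP (R : realType) (a b : seq R) : size a = size b ->
  (forall k, (1 <= k <= size a)%N ->
     \sum_(x <- take k a) x <= \sum_(x <- take k b) x) ->
  \sum_(x <- a) x = \sum_(x <- b) x -> star_maj a b.
Proof.
move=> ab h e; split=> // [k /andP[k1 ka]|].
  by rewrite !sum_ord_take -?ab // h // k1.
by rewrite !sum_ord_take // !take_size.
Qed.

Theorem theorem1p5 (R : realType) (d : nat) (A : 'M[R[i]]_d)
    (alpha beta : {set 'I_d}) :
  posdefmx A ->
  let x := eigvals (princ_submx A alpha) in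
  let y := eigvals (princ_submx A beta) in
  let z := eigvals (princ_submx A (alpha :|: beta)) in
  let w := eigvals (princ_submx A (alpha :&: beta)) in
  [/\ star_maj (sort_dec x ++ sort_inc y) (sort_dec z ++ sort_dec w),
      star_maj (sort_dec x ++ sort_inc y) (sort_dec z ++ sort_inc w)
    & star_maj (sort_dec x ++ sort_dec y) (sort_dec (z ++ w))].
Proof.
move=> [hA _] x y z w.
have xE : size x = #|alpha| := size_eigvals _.
have yE : size y = #|beta| := size_eigvals _.
have zE : size z = #|alpha :|: beta| := size_eigvals _.
have wE : size w = #|alpha :&: beta| := size_eigvals _.
have szE : (size x + size y = size z + size w)%N.
  by rewrite xE yE zE wE cardsUI.
have xz : (size x <= size z)%N by rewrite xE zE subset_leq_card // subsetUl.
have yz : (size y <= size z)%N by rewrite yE zE subset_leq_card // subsetUr.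
have wx : (size w <= size x)%N by rewrite wE xE subset_leq_card // subsetIl.
have sumE : \sum_(t <- x) t + \sum_(t <- y) t = \sum_(t <- z) t + \sum_(t <- w) t.
  exact: sum_ev_UI.
have sumD s : \sum_(t <- sort_dec s) t = \sum_(t <- s) t :> R.
  exact/perm_big/perm_sort_dec.
have sumI s : \sum_(t <- sort_inc s) t = \sum_(t <- s) t :> R.
  by apply/perm_big; rewrite /sort_inc perm_sort.
have top_xz k : (k <= size x)%N -> topsum x k <= topsum z k.
  by rewrite xE; apply: topsum_subset; rewrite // subsetUl.
(* These are the partial sums of the second relation; the first one will be reduced to them. *)
have take_inc k : (1 <= k <= size x + size y)%N ->
    \sum_(t <- take k (sort_dec x ++ sort_inc y)) t <=
    \sum_(t <- take k (sort_dec z ++ sort_inc w)) t.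
  move=> /andP[_ kxy]; rewrite !take_cat !size_sort_dec.
  have [kx|xk] := ltnP k (size x).
    by rewrite (leq_trans kx xz); apply/top_xz/ltnW.
  rewrite big_cat /= sumD sum_take_sort_inc.
  (* [j] is the length of the complementary tails; the left one consists of the [j] largest entries
     of [y]. *)
  pose j := (size x + size y - k)%N.
  have jE : (k - size x = size y - j)%N by rewrite /j; lia.
  have jy : (j <= size y)%N by rewrite /j; lia.
  have yj : topsum y j + botsum y (size y - j) = \sum_(t <- y) t.
    by rewrite -[X in topsum _ X](subKn jy) top_bot.
  (* For [k < size z] the right tail consists of all of [w] and the [j - size w] smallest entries of
     [z]. *)
  rewrite jE; have [kz|zk] := ltnP k (size z).
    have sj : (size w <= j)%N by rewrite /j; lia.
    have j_range : (#|alpha :&: beta| <= j <= #|beta|)%N by rewrite -wE -yE sj.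
    have := sum_ev_capU_le hA j_range; rewrite -/w -/y -/z -wE => le_j.
    have kE : (size z - (j - size w) = k)%N by rewrite /j; lia.
    have := top_bot z (j - size w); rewrite kE /topsum; rewrite /topsum in yj le_j; lra.
  (* Here the right tail consists of the [j] largest entries of [w]. *)
  rewrite big_cat /= sumD sum_take_sort_inc.
  have jw : (j <= size w)%N by rewrite /j; lia.
  have -> : (k - size z = size w - j)%N by rewrite /j; lia.
  have wj : topsum w j + botsum w (size w - j) = \sum_(t <- w) t.
    by rewrite -[X in topsum _ X](subKn jw) top_bot.
  have : topsum w j <= topsum y j.
    by apply: topsum_subset; rewrite ?subsetIr -?wE.
  lra.
split; apply: star_majP;
  rewrite ?big_cat ?size_cat /= ?sumD ?sumI ?size_sort_dec ?size_sort_inc //.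
(* Listing [w] in decreasing instead of increasing order can only raise the partial sums. *)
- move=> k k1; apply: le_trans (take_inc k k1) _.
  rewrite !take_cat size_sort_dec; case: ltnP => // zk.
  rewrite !big_cat /= lerD2l sum_take_sort_inc.
  by apply: botsum_le_topsum; lia.
- by rewrite size_cat.
- move=> k /andP[_ kxy]; rewrite -/(topsum (z ++ w) k).
  rewrite take_cat size_sort_dec; have [kx|xk] := ltnP k (size x).
    apply: le_trans (top_xz _ (ltnW kx)) _.
    rewrite -{2}(_ : size (take k (sort_dec z)) = k); last first.
      by rewrite size_takel // size_sort_dec; lia.
    apply: (@sum_le_topsum _ _ _ (drop k (sort_dec z) ++ w)).
    by rewrite catA cat_take_drop perm_cat2r perm_sort_dec.
  rewrite big_cat /= sumD.
  (* The left tail now consists of the [j] smallest entries of [y], which are compared with the [j]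
     smallest of [z]. *)
  pose j := (size x + size y - k)%N.
  have jy : (j <= size y)%N by rewrite /j; lia.
  have := top_bot y j; rewrite /topsum (_ : (size y - j = k - size x)%N);
    last by rewrite /j; lia.
  have : botsum z j <= botsum y j.
    by apply: botsum_subset; rewrite ?subsetUr -?yE.
  have := top_bot z j.
  have kE : (size z - j + size w = k)%N by rewrite /j; lia.
  (* All of [w] and the [size z - j] largest entries of [z] form a choice of [k] entries of
     [z ++ w]. *)
  have : topsum z (size z - j) + \sum_(t <- w) t <= topsum (z ++ w) k.
    rewrite -big_cat -kE.
    rewrite -{2}(_ : size (take (size z - j) (sort_dec z)) = size z - j)%N;
      last first.
      by rewrite size_takel // size_sort_dec leq_subr.
    rewrite -size_cat; apply: (@sum_le_topsum _ _ _ (drop (size z - j) (sort_dec z))).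
    by rewrite perm_catAC cat_take_drop perm_cat2r perm_sort_dec.
  rewrite /topsum; lra.
- by rewrite big_cat.
Qed.
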